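(* Let $\{S_i\}_{i=1}^m$ be an IFS of similitudes $S_i(x)=rR_ix+d_i$ on $\mathbb R^d$ with common ratio $r\in(0,1)$, and let $(X,\mathcal E)$, $\mathcal E=\mathcal E_v\cup\mathcal E_h$, be its augmented tree with respect to a bounded closed invariant set $J$. Suppose $(X,\mathcal E)$ is simple, with connected classes $\mathscr T_1,\dots,\mathscr T_\kappa$ and incidence matrix $A$, and let $\mathbf b=[b_1,\dots,b_\kappa]^t$, where $b_i=\#T$ for $[T]=\mathscr T_i$. Suppose $A$ is $(m,\mathbf b)$-rearrangeable. Then there is a near-isometry between $(X,\mathcal E)$ and $(X,\mathcal E_v)$, so that $\partial(X,\mathcal E)\simeq\partial(X,\mathcal E_v)$.
   Context: IFS: $S_i(x)=rR_ix+d_i$, $0<r<1$, $R_i$ orthogonal, $d_i\in\mathbb R^d$. $\Sigma=\{1,\dots,m\}$, $X=\bigcup_{n\ge0}\Sigma^n$, $\Sigma^0=\{o\}$ (empty word, root); $S_{\mathbf u}=S_{i_1}\circ\cdots\circ S_{i_n}$ for $\mathbf u=i_1\cdots i_n$. Augmented tree: $J\subset\mathbb R^d$ is a fixed nonempty bounded closed set with $S_i(J)\subset J$ for all $i$; $J_{\mathbf u}=S_{\mathbf u}(J)$. $\mathcal E_v$: (vertical) edges joining $\mathbf u$ and $\mathbf ui$. $\mathcal E_h$ (horizontal edges): pairs $(\mathbf u,\mathbf v)$, $\mathbf u\ne\mathbf v$ in the same level $\Sigma^n$, with $J_{\mathbf u}\cap J_{\mathbf v}\ne\emptyset$. Hyperbolicity: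 for a connected graph with root $o$ and graph distance $d(\cdot,\cdot)$, put $|x|=d(o,x)$, $|x\wedge y|=\frac12(|x|+|y|-d(x,y))$. The graph is hyperbolic if for some $\delta>0$, $|x\wedge y|\ge\min\{|x\wedge z|,|z\wedge y|\}-\delta$ for all $x,y,z$. For fixed $a>0$ with $e^{\delta a}-1<\sqrt2-1$, put $\rho_a(x,y)=e^{-a|x\wedge y|}$ if $x\ne y$ and $0$ if $x=y$; it is comparable up to multiplicative constants to the metric $\theta_a(x,y)=\inf\{\sum_{i=1}^n\rho_a(x_{i-1},x_i):n\ge1,\ x_0=x,\ x_n=y\}$. The hyperbolic boundary is $\partial X=\hat X\setminus X$, $\hat X$ the completion under $\rho_a$ (equivalently $\theta_a$), with $\rho_a$ extended to it. The same $a$ is used for both graphs. A simple augmented tree is hyperbolic. Near-isometry: a bijection $\sigma:X\to Y$ between hyperbolic graphs such that for some $c>0$, $|d(\sigma(x),\sigma(y))-d(x,y)|\le c$ for all $x,y\in X$ ($d$ the graph distances). Simple: a horizontal connected component is a maximal connected horizontal subgraph $T$ of some level $\Sigma^n$. $T\Sigma=\{\mathbf ui:\mathbf u\in T,i\in\Sigma\}$. $T\sim T'$ if there is a bijection $g:T\cup T\Sigma\to T'\cup T'\Sigma$ (as subgraphs of $X$) such that $g,g^{-1}$ preserve vertical and horizontal edges; the class $[T]$ is called a connected class. $X$ is simple if there are finitely many connected classes. Incidence matrix: $A=[a_{ij}]$, where, for any component $T$ with $[T]=\mathscr T_i$, $a_{ij}$ is the number of horizontal connected components $Z$ of $T\Sigma$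 with $[Z]=\mathscr T_j$ (this number being independent of the choice of $T$ in the class). Rearrangeable: a row vector $\mathbf a\in\mathbb Z_{\ge0}^\kappa$ is $(m,\mathbf b)$-rearrangeable ($\mathbf b\in\mathbb N^\kappa$ a column vector with positive integer entries) if there are an integer $p>0$ and a nonnegative integral $p\times\kappa$ matrix $C$ with $\mathbf a=[1,\dots,1]C$ and $C\mathbf b=[m,\dots,m]^t$. A matrix is $(m,\mathbf b)$-rearrangeable if each of its rows is. $\simeq$ (Lipschitz equivalence): existence of a bijection $\sigma$ and $C>0$ with $C^{-1}d(x,y)\le d(\sigma(x),\sigma(y))\le Cd(x,y)$ for all $x,y$. *)

(* Defs.v *)
From HB Require Import structures.
From mathcomp Require Import all_boot all_order all_algebra.
From mathcomp Require Import all_classical all_reals all_analysis.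

Set Implicit Arguments.
Unset Strict Implicit.
Unset Printing Implicit Defensive.

Import Order.TTheory GRing.Theory Num.Theory.
Import numFieldNormedType.Exports.

Local Open Scope classical_set_scope.
Local Open Scope ring_scope.

(* A graph on a vertex type V is given by its adjacency relation
   E : V -> V -> Prop. *)
Section Graphs.
Context {V : Type}.
Implicit Types (E : V -> V -> Prop) (A T : set V).

Fixpoint walk E (n : nat) (x y : V) : Prop :=
  if n is n'.+1 then exists2 z, E x z & walk E n' z y else x = y.

Definition induced E T : V -> V -> Prop :=
  fun x y => [/\ T x, T y & E x y].

Definition connected_graph E := forall x y, exists n, walk E n x y.

Definition connected_in E T :=
  T !=set0 /\ forall x y, T x -> T y -> exists n, walk (induced E T) n x y.

(* T is (the vertex set of) a maximal connected subgraph of E restricted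
   to A. *)
Definition component_of E A T :=
  [/\ T `<=` A, connected_in E T &
      forall T', T' `<=` A -> connected_in E T' -> T `<=` T' -> T' = T].

(* The length of a shortest walk; it is the junk value 0 when there is no
   walk at all from x to y. *)
Definition graph_dist E (x y : V) : nat :=
  xget 0%N [set n | walk E n x y /\ forall k, walk E k x y -> (n <= k)%N].

End Graphs.

Section Hyperbolic.
Context {R : realType} {V : Type}.
Implicit Types (E : V -> V -> Prop) (o : V).

(* |x /\ y| *)
Definition gromov_product E o (x y : V) : R :=
  ((graph_dist E o x)%:R + (graph_dist E o y)%:R - (graph_dist E x y)%:R) / 2.

Definition hyperbolic_with E o (delta : R) :=
  [/\ connected_graph E, 0 < delta &
      forall x y z,
        Num.min (gromov_product E o x z) (gromov_product E o z y) - delta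
          <= gromov_product E o x y].

Definition admissible E o (a : R) :=
  0 < a /\ exists delta,
    hyperbolic_with E o delta /\ expR (delta * a) - 1 < Num.sqrt 2 - 1.

Definition rho E o (a : R) (x y : V) : R :=
  if `[< x = y >] then 0 else expR (- a * gromov_product E o x y).

End Hyperbolic.

Definition hyperbolic (R : realType) (V : Type) (E : V -> V -> Prop) (o : V) :=
  exists delta : R, hyperbolic_with E o delta.

(* Completion of V for a symmetric function D vanishing on the diagonal and
   satisfying D x z <= K * max (D x y) (D y z), such as rho. *)
Section Completion.
Context {R : realType} {V : Type}.
Variable D : V -> V -> R.

Definition cauchy_for (x : nat -> V) :=
  forall e, 0 < e -> exists N, forall p q,
    (N <= p)%N -> (N <= q)%N -> D (x p) (x q) < e.

Definition same_limit (x y : nat -> V) := D (x n) (y n) @[n --> \oo] --> 0.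

Definition cauchy_class (x : nat -> V) : set (nat -> V) :=
  [set y | cauchy_for y /\ same_limit x y].

Definition completion : set (set (nat -> V)) :=
  cauchy_class @` cauchy_for.

(* v : V is identified with the class of the constant sequence v. *)
Definition completion_boundary : set (set (nat -> V)) :=
  completion `\` range (fun v : V => cauchy_class (fun=> v)).

(* As rho need not be continuous, its extension to the completion is taken to
   be the supremum of limsup D (x n) (y n) over all representatives. For rho
   this is expR (- a * inf liminf |x n /\ y n|), and it coincides with the
   usual extension when D is a metric. *)
Definition extended_dist (xi eta : set (nat -> V)) : R :=
  sup [set limn_sup (fun n => D (x n) (y n)) | x in xi & y in eta].

End Completion.

Definition lipschitz_equivalent (R : realType) (T U : Type)
    (A : set T) (dA : T -> T -> R) (B : set U) (dB : U -> U -> R) :=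
  exists f : T -> U, set_bij A B f /\
  exists C : R, 0 < C /\ forall x y, A x -> A y ->
    C^-1 * dA x y <= dB (f x) (f y) <= C * dA x y.

Definition boundary_equivalent (R : realType) (a : R) (V W : Type)
    (E : V -> V -> Prop) (o : V) (E' : W -> W -> Prop) (o' : W) :=
  lipschitz_equivalent
    (completion_boundary (rho E o a)) (extended_dist (rho E o a))
    (completion_boundary (rho E' o' a)) (extended_dist (rho E' o' a)).

Definition near_isometry (R : realType) (V W : Type)
    (E : V -> V -> Prop) (E' : W -> W -> Prop) (sigma : V -> W) :=
  bijective sigma /\ exists c : R, 0 < c /\ forall x y,
    `|(graph_dist E' (sigma x) (sigma y))%:R - (graph_dist E x y)%:R| <= c.

(* Near-isometries are only considered between hyperbolic graphs. *)
Definition near_isometric (R : realType) (V W : Type)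
    (E : V -> V -> Prop) (o : V) (E' : W -> W -> Prop) (o' : W) :=
  [/\ hyperbolic R E o, hyperbolic R E' o' &
      exists sigma : V -> W, near_isometry R E E' sigma].

Section AugmentedTree.
Context {R : realType} {d m : nat}.

Definition similitude (r : R) (Q : 'M[R]_d) (t : 'cV[R]_d) (x : 'cV[R]_d) :=
  r *: (Q *m x) + t.

Definition orthogonal_mx (Q : 'M[R]_d) := Q *m Q^T = 1%:M.

(* Words over the alphabet 'I_m; the root is [::]. *)
Definition word := seq 'I_m.

Definition level (n : nat) : set word := [set u | size u = n].

Definition vertical (u v : word) : Prop :=
  exists i, v = rcons u i \/ u = rcons v i.

Definition successors (T : set word) : set word :=
  [set w | exists u i, T u /\ w = rcons u i].

Variables (S : 'I_m -> 'cV[R]_d -> 'cV[R]_d) (J : set 'cV[R]_d).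

(* S_(i1...in) = S_i1 \o ... \o S_in *)
Definition word_map (u : word) : 'cV[R]_d -> 'cV[R]_d :=
  foldr (fun i f => S i \o f) id u.

Definition cell (u : word) : set 'cV[R]_d := word_map u @` J.

Definition horizontal (u v : word) : Prop :=
  [/\ u <> v, size u = size v & cell u `&` cell v !=set0].

Definition augmented (u v : word) : Prop := vertical u v \/ horizontal u v.

Definition horizontal_component (T : set word) :=
  exists n, component_of horizontal (level n) T.

Definition component_equiv (T T' : set word) :=
  exists g : word -> word,
    set_bij (T `|` successors T) (T' `|` successors T') g /\
    forall u v, (T `|` successors T) u -> (T `|` successors T) v ->
      (vertical u v <-> vertical (g u) (g v)) /\
      (horizontal u v <-> horizontal (g u) (g v)).

Definition connected_class (T : set word) : set (set word) :=
  [set T' | horizontal_component T' /\ component_equiv T T'].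

Definition connected_classes : set (set (set word)) :=
  connected_class @` horizontal_component.

Definition simple_augmented := finite_set connected_classes.

Definition class_enumeration kappa (cls : 'I_kappa -> set (set word)) :=
  set_bij [set: 'I_kappa] connected_classes cls.

Definition class_sizes kappa (cls : 'I_kappa -> set (set word))
    (b : 'cV[nat]_kappa) :=
  forall i T, horizontal_component T -> connected_class T = cls i ->
    (T #= `I_(b i ord0))%card.

Definition incidence_matrix kappa (cls : 'I_kappa -> set (set word))
    (A : 'M[nat]_kappa) :=
  forall i T, horizontal_component T -> connected_class T = cls i ->
  forall j,
    ([set Z | component_of horizontal (successors T) Z
              /\ connected_class Z = cls j] #= `I_(A i j))%card.

End AugmentedTree.

Definition rearrangeable_row kappa (m : nat) (b : 'cV[nat]_kappa)
    (a : 'rV[nat]_kappa) :=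
  (forall i, (0 < b i ord0)%N) /\
  exists p (C : 'M[nat]_(p, kappa)),
    [/\ (0 < p)%N, a = const_mx 1%N *m C & C *m b = const_mx m].

Definition rearrangeable_mx kappa (m : nat) (b : 'cV[nat]_kappa)
    (A : 'M[nat]_kappa) :=
  forall i, rearrangeable_row m b (row i A).

(* Main.v *)
Require Import Defs.
From HB Require Import structures.
From mathcomp Require Import all_boot all_order all_algebra.
From mathcomp Require Import all_classical all_reals all_analysis.
From mathcomp Require Import zify lra.

Set Implicit Arguments.
Unset Strict Implicit.
Unset Printing Implicit Defensive.

Import Order.TTheory GRing.Theory Num.Theory.
Import numFieldNormedType.Exports.
Local Open Scope classical_set_scope.
Local Open Scope ring_scope.

(** Write u ~ v when two words are joined by a horizontal path.  A word keeps
    its m vertical children, but these may lie in the same horizontal component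
    as children of another word; the proof regrows the tree so that this no
    longer happens.

    Let T be a component of class i.  The components of its successors have
    total size m #T, and row i of A says how many of them there are in each
    class.  Writing this row as a sum of the rows of C, each of weight m against
    b, distributes the components among #T groups of m words each
    ([rearrange_blocks]).  Handing one group to each word of T gives every word u
    of the level m new children h u c such that h u c has its old parent in the
    component of u, and h u c ~ h v c' only for u = v ([reassigned_children]).
    The new tree is again the full m-ary tree, so reading a word as an address in
    it is a level-preserving bijection tau of the words ([tree_reassignment]).

    Up to a constant, distances in an augmented tree are governed by common
    ancestors modulo ~ : since adjacent vertices have equal or vertically
    adjacent components, a walk of length n from x to y produces a level s at
    which the ancestors of x and y are related, with |x| + |y| <= n + 2 s;
    conversely related ancestors at level s give
    d(x,y) <= |x| + |y| - 2 s + N, where N bounds the size of a component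
    ([tree_dist_ge], [tree_dist_le]).  With ~ replaced by equality, the same
    applies to the tree without horizontal edges.  Hyperbolicity of both graphs
    follows, because being related at level s is transitive
    ([tree_with_hyperbolic]).  Equal ancestors of addresses become related
    ancestors under tau, and related ancestors come from addresses that agree one
    level higher, so tau changes distances by at most a constant
    ([dist_reassignment]), and its inverse sigma is the required near-isometry.

    Finally sigma preserves levels, so it changes Gromov products by a bounded
    amount and rho by a bounded factor; composing Cauchy sequences with sigma is
    then a bi-Lipschitz bijection of the boundaries ([lipschitz_boundary]). *)

(** * Matching finite types with equal fibres *)

Lemma fibre_matching (X Y K : finType) (f : X -> K) (g : Y -> K) :
  (forall k, #|[pred x | f x == k]| = #|[pred y | g y == k]|) ->
  exists h : X -> Y, bijective h /\ forall x, g (h x) = f x.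
Proof.
move=> fg.
have card_fibres (Z : finType) (u : Z -> K) :
    #|Z| = (\sum_k #|[pred z | u z == k]|)%N.
  rewrite -sum1_card (partition_big u predT) //=.
  by apply: eq_bigr => k _; rewrite -sum1_card.
have cXY : #|X| = #|Y|.
  by rewrite (card_fibres _ f) (card_fibres _ g); apply: eq_bigr.
have [/card0_eq X0|/card_gt0P[x0 _]] := posnP #|X|.
  have hX (x : X) : False by have := X0 x; rewrite inE.
  have hY (y : Y) : False.
    have : (0 < #|Y|)%N by apply/card_gt0P; exists y.
    by rewrite -cXY => /card_gt0P[x].
  exists (fun x => match hX x with end); split=> [|x]; last by case: (hX x).
  by exists (fun y => match hY y with end) => z; [case: (hX z)|case: (hY z)].
have /card_gt0P[y0 _] : (0 < #|Y|)%N by rewrite -cXY; apply/card_gt0P; exists x0.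
pose F x := enum [pred x' | f x' == f x].
pose G x := enum [pred y | g y == f x].
have sFG x : size (F x) = size (G x) by rewrite /F /G -!cardE fg.
have xF x : x \in F x by rewrite mem_enum inE.
pose h x := nth y0 (G x) (index x (F x)).
have gh x : g (h x) = f x.
  have : h x \in G x by rewrite mem_nth // -sFG index_mem.
  by rewrite mem_enum inE => /eqP.
exists h; split=> //.
apply: inj_card_bij; last by rewrite cXY.
move=> x x' hxx'.
have fxx' : f x = f x' by rewrite -!gh hxx'.
move: hxx' (xF x) (xF x') (sFG x).
rewrite /h /F /G fxx' => /eqP + ix ix' s.
rewrite nth_uniq ?enum_uniq // -?s ?index_mem // => /eqP.
by move=> /(congr1 (nth x (enum [pred x'0 | f x'0 == f x'])));
  rewrite !nth_index.
Qed.

(** Splitting into blocks of prescribed sizes and grouping the blocks: B is a set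
    of blocks, block beta having b (ty beta) elements, and C k j is the number of
    blocks of type j that group k should receive.  The matching principle is used
    twice: once to send blocks to groups with the multiplicities C, once to number
    the m elements of each group. *)
Lemma rearrange_blocks (kappa p m : nat) (b : 'I_kappa -> nat)
    (C : 'I_p -> 'I_kappa -> nat) (Y B : finType) (blk : Y -> B)
    (ty : B -> 'I_kappa) :
  (forall j, #|[pred beta | ty beta == j]| = \sum_k C k j)%N ->
  (forall beta, #|[pred y | blk y == beta]| = b (ty beta)) ->
  (forall k, \sum_j C k j * b j = m)%N ->
  exists h : Y -> 'I_p * 'I_m, bijective h /\
    forall y y', blk y = blk y' -> (h y).1 = (h y').1.
Proof.
move=> tyC blkb Cb.
(* D consists of the slots to be filled: slot (j, (k, c)) is the c-th place for
   a block of type j in group k. *)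
pose D := {j : 'I_kappa & {k : 'I_p & 'I_(C k j)}}.
have cardD j (P : pred 'I_p) :
    (#|[pred z : D | (tag z == j) && P (tag (tagged z))]| =
     \sum_(k | P k) C k j)%N.
  rewrite -sum1_card.
  rewrite -(@sig_big_dep _ _ _ _ _ (pred1 j)
             (fun j' z => P (tag z)) (fun _ _ => 1%N)) /=.
  rewrite big_pred1_eq.
  transitivity (\sum_(k | P k) \sum_(c < C k j) 1)%N.
    by rewrite sig_big_dep; apply: eq_bigl => z; rewrite andbT.
  by apply: eq_bigr => k _; rewrite sum1_card card_ord.
have [j|h [hbij hty]] := @fibre_matching B D _ ty (fun z => tag z).
  rewrite tyC -(cardD j xpredT) -!sum1_card.
  by apply: eq_bigl => z; rewrite !inE andbT.
pose row beta := tag (tagged (h beta)).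
have card_row k j :
    #|[pred beta | (ty beta == j) && (row beta == k)]| = C k j.
  have <- : (\sum_(k' | k' == k) C k' j)%N = C k j by rewrite big_pred1_eq.
  rewrite -cardD -!sum1_card [RHS](reindex h) /=; last exact: onW_bij.
  by apply: eq_bigl => z; rewrite !inE -hty.
have card_row_blk k : #|[pred y | row (blk y) == k]| = m.
  rewrite -sum1_card (partition_big blk (fun beta => row beta == k)) //=.
  rewrite (partition_big ty predT) //= -(Cb k); apply: eq_bigr => j _.
  rewrite -card_row -sum_nat_const.
  apply: eq_big => [beta|beta /andP[/eqP rk /eqP tj]]; first by rewrite inE andbC.
  rewrite -tj -blkb -sum1_card; apply: eq_bigl => y.
  rewrite !inE; case: (eqVneq (blk y) beta) => [->|_]; last by rewrite andbF.
  by rewrite rk eqxx.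
have [k|g [gbij grow]] :=
    @fibre_matching Y ('I_p * 'I_m)%type _ (row \o blk) (fun z => z.1).
  rewrite card_row_blk -sum1_card.
  transitivity (\sum_(k' | k' == k) \sum_(c < m) 1)%N.
    by rewrite big_pred1_eq sum1_card card_ord.
  by rewrite pair_big_dep; apply: eq_bigl => z; rewrite andbT.
by exists g; split=> // y y' yy'; rewrite !grow /= yy'.
Qed.

(** * Walks and connected components *)

Definition linked (V : Type) (E : V -> V -> Prop) (x y : V) :=
  exists n, walk E n x y.

Definition component (V : Type) (E : V -> V -> Prop) (x : V) : set V :=
  [set y | linked E x y].

Lemma walk_cat (V : Type) (E : V -> V -> Prop) n k (x y z : V) :
  walk E n x y -> walk E k y z -> walk E (n + k) x z.
Proof.
elim: n x => [|n IHn] x /=; first by move=> ->.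
by move=> [u xu uy] yz; exists u => //; apply: IHn.
Qed.

Lemma walk_sym (V : Type) (E : V -> V -> Prop) :
  (forall x y, E x y -> E y x) ->
  forall n x y, walk E n x y -> walk E n y x.
Proof.
move=> Esym; elim=> [|n IHn] x y /=; first by move=> ->.
move=> [z xz /IHn yz].
suff: walk E (n + 1) y x by rewrite addn1.
by apply: walk_cat yz _; exists x => //; apply: Esym.
Qed.

Lemma walk_mono (V : Type) (E E' : V -> V -> Prop) :
  (forall x y, E x y -> E' x y) ->
  forall n x y, walk E n x y -> walk E' n x y.
Proof.
move=> EE'; elim=> [//|n IHn] x y /= [z xz zy].
by exists z; [apply: EE'|apply: IHn].
Qed.

Section Components.
Variables (V : Type) (E : V -> V -> Prop).
Hypothesis Esym : forall x y, E x y -> E y x.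

Lemma linked_refl x : linked E x x.
Proof. by exists 0%N. Qed.

Lemma linked_edge x y : E x y -> linked E x y.
Proof. by move=> xy; exists 1%N, y. Qed.

Lemma linked_trans y x z : linked E x y -> linked E y z -> linked E x z.
Proof. by move=> [n xy] [k yz]; exists (n + k)%N; apply: walk_cat yz. Qed.

Lemma linked_sym x y : linked E x y -> linked E y x.
Proof. by move=> [n xy]; exists n; apply: walk_sym. Qed.

Lemma componentP x y : linked E x y <-> component E x = component E y.
Proof.
split=> [xy|eq_xy]; last first.
  have : component E y y by apply: linked_refl.
  by rewrite -eq_xy.
apply/seteqP; split=> z; last exact: linked_trans.
by apply: linked_trans; apply: linked_sym.
Qed.

(** Inside any set closed under adjacency the maximal connected subgraphs are the
    classes of [linked], so components of a level, of a set of successors, and of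
    the whole graph can be treated alike. *)
Lemma component_ofP (A Z : set V) :
  (forall x y, A x -> E x y -> A y) ->
  component_of E A Z <-> exists2 x, A x & Z = component E x.
Proof.
move=> Aclosed.
have subA x : A x -> component E x `<=` A.
  move=> Ax y [n]; elim: n x Ax => [|n IHn] x Ax /=; first by move=> <-.
  by move=> [z xz]; apply: IHn; apply: Aclosed xz.
have conn_component x : connected_in E (component E x).
  split; first by exists x; apply: linked_refl.
  move=> y z xy xz; have [n] := linked_trans (linked_sym xy) xz.
  exists n; elim: n y xy p => [//|n IHn] y xy /= [u yu uz].
  have xu : linked E x u by apply: linked_trans xy (linked_edge yu).
  by exists u => //; apply: IHn.
have sub_component x (T : set V) :
    T x -> connected_in E T -> T `<=` component E x.
  move=> Tx [_ Tconn] y Ty; have [n xy] := Tconn _ _ Tx Ty.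
  by exists n; apply: walk_mono xy => u v [].
split=> [[ZA Zconn Zmax]|[x Ax ->]].
  have [[x Zx] _] := Zconn; exists x; first exact: ZA.
  by rewrite [RHS](Zmax (component E x))//; [apply/subA/ZA|apply: sub_component].
split=> //; first exact: subA.
move=> T TA Tconn xT; apply/seteqP; split=> //.
by apply: sub_component Tconn; apply/xT/linked_refl.
Qed.

End Components.

Lemma card_eq_enum (V : Type) (Z : set V) n :
  (Z #= `I_n)%card -> exists e : 'I_n -> V, injective e /\ range e = Z.
Proof.
move=> /card_set_bijP[f [fZ finj fsurj]].
have /choice[e he] : forall k : 'I_n, exists v, Z v /\ f v = k.
  by move=> k; have [v Zv vk] := fsurj k (ltn_ord k); exists v.
exists e; split=> [k k' ekk'|].
  by apply/val_inj; rewrite /= -(he k).2 -(he k').2 ekk'.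
apply/seteqP; split=> [_ [k _ <-]|v Zv]; first exact: (he k).1.
exists (Ordinal (fZ v Zv)) => //.
by apply: finj; rewrite ?inE ?(he _).2 //; exact: (he _).1.
Qed.

Lemma card_preimage (V : Type) (Y : finType) (g : Y -> V) (P : pred Y)
    (Z : set V) n :
  injective g -> (forall y, P y <-> Z (g y)) -> Z `<=` range g ->
  (Z #= `I_n)%card -> #|P| = n.
Proof.
move=> ginj PZ Zg /card_eq_enum[e [einj eZ]].
have /choice[f fE] : forall k, exists y, g y = e k.
  by move=> k; have [|y _ <-] := Zg (e k); [rewrite -eZ; exists k|exists y].
have finj : injective f.
  by move=> k k' fkk'; apply: einj; rewrite -!fE fkk'.
rewrite -[RHS]card_ord -(card_codom finj); apply: eq_card => y.
apply/idP/codomP => [/PZ|[k ->]]; last by apply/PZ; rewrite fE -eZ; exists k.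
by rewrite -eZ => -[k _ ky]; exists k; apply: ginj; rewrite fE ky.
Qed.

(** A walk without repeated vertices visits each vertex of the component at most
    once. *)
Lemma walk_shorten (V : eqType) (E : V -> V -> Prop) n N (x y : V) :
  (component E x #= `I_N)%card -> walk E n x y ->
  exists2 k, (k <= N)%N & walk E k x y.
Proof.
move=> /card_eq_enum[e [einj eE]] xy.
pose r u v := `[< E u v >].
have pathE s z : path r z s -> walk E (size s) z (last z s).
  elim: s z => [//|w s IHs] z /= /andP[/asboolP zw ws].
  by exists w => //; apply: IHs.
have [s xs ->] : exists2 s, path r x s & y = last x s.
  elim: n x xy {eE} => [|n IHn] x /=; first by move=> <-; exists [::].
  move=> [z xz /IHn[s zs ->]]; exists (z :: s) => //=.
  by rewrite zs andbT; apply/asboolP.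
case: (shortenP xs) => s' xs' us' _.
exists (size s'); last exact: pathE.
have : (size (x :: s') <= size (codom e))%N.
  apply: uniq_leq_size us' _ => z zs'.
  have : component E x z.
    move: zs'; rewrite inE => /predU1P[->|zs']; first exact: linked_refl.
    by case/splitPl: {zs'}(mem_behead (s := x :: s') zs') xs' => s1 s2 <-;
      rewrite cat_path => /andP[/pathE x1 _]; exists (size s1).
  by rewrite -eE => -[k _ <-]; apply: codom_f.
by rewrite size_codom card_ord => /ltnW.
Qed.

Lemma graph_dist_spec (V : Type) (E : V -> V -> Prop) n (x y : V) :
  walk E n x y ->
  walk E (graph_dist E x y) x y /\
  forall k, walk E k x y -> (graph_dist E x y <= k)%N.
Proof.
move=> xy; rewrite /graph_dist.
have ex : exists n, `[< walk E n x y >] by exists n; apply/asboolP.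
case: (ex_minnP ex) => d /asboolP dxy dmin.
pose P := [set n | walk E n x y /\ forall k, walk E k x y -> (n <= k)%N].
suff Pd : P d by exact: (xgetI 0%N Pd).
by split=> // k kxy; apply/dmin/asboolP.
Qed.

Lemma graph_dist_walk (V : Type) (E : V -> V -> Prop) n (x y : V) :
  walk E n x y -> walk E (graph_dist E x y) x y.
Proof. by move=> xy; have [] := graph_dist_spec xy. Qed.

Lemma graph_dist_le (V : Type) (E : V -> V -> Prop) n (x y : V) :
  walk E n x y -> (graph_dist E x y <= n)%N.
Proof. by move=> xy; have [_] := graph_dist_spec xy; apply. Qed.

(** * Giving every word new children *)

(** H stands for the horizontal edges.  The third hypothesis is the combinatorial
    trace of the nesting of the cells; it makes horizontal connection pass to
    ancestors. *)
Section Words.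
Variables (m : nat) (H : @word m -> @word m -> Prop).
Hypothesis Hsym : forall u v, H u v -> H v u.
Hypothesis Hsize : forall u v, H u v -> size u = size v.
Hypothesis Hparent :
  forall u v i j, H (rcons u i) (rcons v j) -> u = v \/ H u v.

Lemma linked_size u v : linked H u v -> size u = size v.
Proof.
by move=> [n]; elim: n u => [|n IHn] u /=; [move->|move=> [w /Hsize-> /IHn]].
Qed.

Lemma linked_take k u v : linked H u v -> linked H (take k u) (take k v).
Proof.
have edge x y : H x y -> linked H (take k x) (take k y).
  elim/last_ind: x y => [|x i IHx] y xy; have := Hsize xy.
    by move=> /esym/size0nil->; apply: linked_refl.
  case/lastP: y xy => [|y j] xy; first by rewrite size_rcons.
  rewrite !size_rcons => -[sxy].
  have [kx|xk] := leqP k (size x); last first.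
    by rewrite !take_oversize ?size_rcons -?sxy//; apply: linked_edge.
  rewrite -!cats1 !takel_cat -?sxy//.
  by have [->|/IHx] := Hparent xy; first exact: linked_refl.
move=> [n]; elim: n u => [|n IHn] u /=; first by move=> ->; apply: linked_refl.
by move=> [w /edge uw /IHn]; apply: linked_trans.
Qed.

Lemma linked_parent u v i j : linked H (rcons u i) (rcons v j) -> linked H u v.
Proof.
move=> uv; have := linked_size uv; rewrite !size_rcons => -[suv].
have := linked_take (size u) uv.
by rewrite -!cats1 !takel_cat -?suv// take_size suv take_size.
Qed.

Lemma successors_component_closed x u v :
  successors (component H x) u -> H u v -> successors (component H x) v.
Proof.
move=> [u' [c [xu' ->]]] uv; have := Hsize uv.
case/lastP: v uv => [|v' c'] uv; first by rewrite size_rcons.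
move=> _; exists v', c'; split=> //; apply: linked_trans xu' _.
exact: linked_parent (linked_edge uv).
Qed.

Section Rearrangement.
Variables (kappa : nat) (ty : set (@word m) -> 'I_kappa).
Variables (b : 'cV[nat]_kappa) (A : 'M[nat]_kappa).
Hypothesis bP :
  forall x, (component H x #= `I_(b (ty (component H x)) ord0))%card.
Hypothesis AP : forall x j,
  ([set Z | component_of H (successors (component H x)) Z /\ ty Z = j]
     #= `I_(A (ty (component H x)) j))%card.
Hypothesis rearr : rearrangeable_mx m b A.

(** Rearrangeability at work in one component T: the blocks are the components of
    the successors of T.  Counting these successors in two ways, m #T = p m, shows
    that there is one row of C, hence one group of m successors, for each word
    of T. *)
Lemma reassigned_children_component x :
  exists h : @word m -> 'I_m -> @word m,
  [/\ forall u c, component H x u -> successors (component H x) (h u c),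
      forall u v c c', component H x u -> component H x v ->
        linked H (h u c) (h v c') -> u = v,
      forall u c c', component H x u -> h u c = h u c' -> c = c' &
      forall y, successors (component H x) y ->
        exists u c, component H x u /\ y = h u c].
Proof.
set T := component H x; pose i := ty T.
have [bpos [p [C [_ AC Cb]]]] := rearr i.
have [e [einj eT]] := card_eq_enum (bP x).
have eP k : T (e k) by rewrite /T -eT; exists k.
(* Y indexes the successors of T by parent and letter; B below indexes their
   components by class and rank within the class. *)
pose Y := ('I_(b i ord0) * 'I_m)%type.
pose g (y : Y) := rcons (e y.1) y.2.
have ginj : injective g.
  by move=> [k c] [k' c'] /rcons_inj/= -[/einj-> ->].
have gT y : successors T (g y) by exists (e y.1), y.2.
have gsurj z : successors T z -> range g z.
  by move=> [u [c [+ ->]]]; rewrite /T -eT => -[k _ <-]; exists (k, c).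
have Tclosed := @successors_component_closed x.
have blockP := component_ofP Hsym _ Tclosed.
pose B := {j : 'I_kappa & 'I_(A i j)}.
pose E j := projT1 (cid (card_eq_enum (AP x j))).
have Einj j : injective (E j) by exact: (projT2 (cid (card_eq_enum (AP x j)))).1.
have ET j : range (E j) = [set Z | component_of H (successors T) Z /\ ty Z = j].
  exact: (projT2 (cid (card_eq_enum (AP x j)))).2.
pose block (z : B) := E (tag z) (tagged z).
have blockE z : component_of H (successors T) (block z) /\ ty (block z) = tag z.
  have : range (E (tag z)) (block z) by exists (tagged z).
  by rewrite ET.
have block_inj : injective block.
  move=> z z' eq_zz'; have := (blockE z).2; rewrite eq_zz' (blockE z').2.
  case: z z' eq_zz' => [j k] [j' k'] + /= jj'.
  by subst j'; rewrite /block /= => /Einj->.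
have /choice[blk blkE] : forall y, exists z, block z = component H (g y).
  move=> y.
  have : [set Z | component_of H (successors T) Z /\ ty Z = ty (component H (g y))]
           (component H (g y)).
    by split=> //; apply/blockP; exists (g y).
  by rewrite -ET => -[k _ kE]; exists (Tagged (fun j => 'I_(A i j)) k).
have card_blk z : #|[pred y | blk y == z]| = b (tag z) ord0.
  have /blockP[w Tw zw] := (blockE z).1.
  rewrite -(blockE z).2 zw; apply: card_preimage ginj _ _ (bP w) => [y|v wv].
    rewrite -zw inE; split=> [/eqP<-|].
      by rewrite blkE; apply: linked_refl.
    rewrite zw => /(componentP Hsym) wy; apply/eqP/block_inj.
    by rewrite blkE zw wy.
  apply: gsurj; have [n] := wv.
  elim: n w Tw {zw wv} => [|n IHn] w Tw /=; first by move<-.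
  by move=> [z' wz']; apply: IHn; apply: Tclosed wz'.
have card_ty j : #|[pred z : B | tag z == j]| = (\sum_k C k j)%N.
  transitivity (\sum_(j' | j' == j) \sum_(k < A i j') 1)%N.
    by rewrite sig_big_dep -sum1_card; apply: eq_bigl => z; rewrite !inE andbT.
  rewrite big_pred1_eq sum1_card card_ord.
  have /rowP/(_ j) := AC; rewrite !mxE => ->.
  by apply: eq_bigr => k _; rewrite !mxE mul1r.
have sum_row k : (\sum_j C k j * b j ord0 = m)%N.
  by have /colP/(_ k) := Cb; rewrite !mxE.
have [f [[f' fK f'K] fblk]] := rearrange_blocks card_ty card_blk sum_row.
(* The number p of rows equals #T, unless there are no letters at all. *)
have /eqP : (b i ord0 * m = p * m)%N.
  by have := bij_eq_card (Bijective fK f'K); rewrite !card_prod !card_ord.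
rewrite eqn_mul2r => /orP[/eqP m0|/eqP bp].
  have no_letter (c : 'I_m) : False by move: (c); rewrite m0 => -[].
  exists (fun u _ => u); split=> [u c|u v c|u c|y [u [c]]];
    by case: (no_letter c).
move: f f' fK f'K fblk; rewrite -bp => f f' fK f'K fblk.
have /choice[k kP] : forall u, exists k, T u -> e k = u.
  move=> u; have [Tu|nTu] := pselect (T u).
    have : range e u by rewrite eT.
    by move=> [k _ <-]; exists k.
  by exists (Ordinal (bpos i)).
exists (fun u c => g (f' (k u, c))); split.
- by move=> u c _; apply: gT.
- move=> u v c c' Tu Tv /(componentP Hsym); rewrite -!blkE => /block_inj/fblk.
  by rewrite !f'K /= => kuv; rewrite -(kP u Tu) -(kP v Tv) kuv.
- by move=> u c c' _ /ginj/(can_inj f'K)[].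
- move=> y /gsurj[z _ <-]; exists (e (f z).1), (f z).2; split=> //.
  have -> : k (e (f z).1) = (f z).1 by apply: einj; apply: kP.
  by rewrite -surjective_pairing fK.
Qed.

(** h u c is the c-th child of u in a new tree on the words.  The new parent of a
    word lies in the component of its old parent, and horizontally connected words
    are new siblings. *)
Lemma reassigned_children :
  exists h : @word m -> 'I_m -> @word m,
  [/\ forall u c, exists v c', h u c = rcons v c' /\ linked H u v,
      forall u v c c', linked H (h u c) (h v c') -> u = v,
      forall u c c', h u c = h u c' -> c = c' &
      forall y i, exists u c, rcons y i = h u c].
Proof.
(* The same function h must serve all words of a component, so it is chosen per
   component and not per word. *)
have /choice[hT hTP] : forall T, exists h : @word m -> 'I_m -> @word m,
    forall x, T = component H x ->
  [/\ forall u c, T u -> successors T (h u c),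
      forall u v c c', T u -> T v -> linked H (h u c) (h v c') -> u = v,
      forall u c c', T u -> h u c = h u c' -> c = c' &
      forall y, successors T y -> exists u c, T u /\ y = h u c].
  move=> T; have [[x ->]|noT] := pselect (exists x, T = component H x).
    by have [h hP] := reassigned_children_component x; exists h.
  by exists (fun u _ => u) => x Tx; case: noT; exists x.
have self u : component H u u by apply: linked_refl.
pose h u c := hT (component H u) u c.
have hchild u c : exists v c', h u c = rcons v c' /\ linked H u v.
  have [hs _ _ _] := hTP _ u erefl.
  by have [v [c' [uv hu]]] := hs u c (self u); exists v, c'.
exists h; split=> //.
- move=> u v c c' uv; have [u' [cu [hu uu']]] := hchild u c.
  have [v' [cv [hv vv']]] := hchild v c'.
  have eq_uv : component H u = component H v.
    apply/(componentP Hsym)/(linked_trans uu')/linked_trans/(linked_sym Hsym vv').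
    by move: uv; rewrite hu hv; apply: linked_parent.
  have [_ hinj _ _] := hTP _ u erefl; apply: (hinj u v c c' (self u)).
  + by rewrite eq_uv.
  + by move: uv; rewrite /h -eq_uv; apply.
- move=> u c c'; have [_ _ hinj _] := hTP _ u erefl.
  exact: hinj.
- move=> y i; have [_ _ _ hsurj] := hTP _ y erefl.
  have [|u [c [yu ->]]] := hsurj (rcons y i); first by exists y, i.
  exists u, c; rewrite /h.
  by move: yu => /(componentP Hsym)->.
Qed.

End Rearrangement.

(** * The isomorphism onto the new tree *)

(** tau w is the vertex with address w in the new tree.  Old and new ancestors of
    tau w at level k are horizontally connected: this holds one level up by the
    choice of h, and horizontal connection passes to old parents. *)
Lemma tree_reassignment (h : @word m -> 'I_m -> @word m) :
  (forall u c, exists v c', h u c = rcons v c' /\ linked H u v) ->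
  (forall u v c c', linked H (h u c) (h v c') -> u = v) ->
  (forall u c c', h u c = h u c' -> c = c') ->
  (forall y i, exists u c, rcons y i = h u c) ->
  exists tau : @word m -> @word m,
  [/\ bijective tau, forall w, size (tau w) = size w,
      forall k w, linked H (take k (tau w)) (tau (take k w)) &
      forall u v i j, linked H (tau (rcons u i)) (tau (rcons v j)) -> u = v].
Proof.
move=> hchild hlink hinj hsurj.
have hsize u c : size (h u c) = (size u).+1.
  by have [v [c' [-> /linked_size->]]] := hchild u c; rewrite size_rcons.
pose tau := foldl h [::].
have tau_rcons w i : tau (rcons w i) = h (tau w) i.
  by rewrite /tau -cats1 foldl_cat.
have tau_size w : size (tau w) = size w.
  elim/last_ind: w => [//|w i IHw]; by rewrite tau_rcons hsize IHw size_rcons.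
have tau_inj : injective tau.
  elim/last_ind=> [|u i IHu] v eq_uv; have := congr1 size eq_uv;
    rewrite !tau_size.
    by move=> /esym/size0nil.
  case/lastP: v eq_uv => [|v j]; first by rewrite size_rcons.
  rewrite !tau_rcons => huv _.
  have tuv : tau u = tau v by apply: (@hlink _ _ i j); rewrite huv; apply: linked_refl.
  by rewrite (IHu _ tuv); congr rcons; move: huv; rewrite tuv; apply: hinj.
have tau_surj y : exists w, tau w = y.
  have [n] := ubnP (size y); elim: n y => [//|n IHn] y.
  case/lastP: y => [|y i]; first by exists [::].
  have [u [c yh]] := hsurj y i; rewrite yh hsize ltnS => /IHn[w <-].
  by exists (rcons w c); rewrite tau_rcons.
exists tau; split=> //.
- have /choice[sigma tauK] := tau_surj.
  by exists sigma => // w; apply: tau_inj; rewrite tauK.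
- move=> k; elim/last_ind=> [|w i IHw]; first by rewrite /=; apply: linked_refl.
  have [kw|wk] := leqP k (size w); last first.
    by rewrite !take_oversize ?tau_size ?size_rcons//; apply: linked_refl.
  rewrite -[in take k (rcons w i)]cats1 takel_cat// tau_rcons.
  have [v [c [-> wv]]] := hchild (tau w) i.
  have kv : (k <= size v)%N by rewrite -(linked_size wv) tau_size.
  rewrite -cats1 takel_cat//; apply: linked_trans IHw.
  exact/linked_take/(linked_sym Hsym).
- by move=> u v i j; rewrite !tau_rcons => /hlink/tau_inj.
Qed.

(** * Distances in a tree with horizontal edges *)

(** Taking for H the empty relation gives the bare tree, so that what follows
    covers both graphs. *)
Definition tree_with (u v : @word m) := vertical u v \/ H u v.

Lemma tree_with_sym u v : tree_with u v -> tree_with v u.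
Proof.
by move=> [[i [uv|uv]]|/Hsym]; [left; exists i; right|left; exists i; left|right].
Qed.

(** The level s drops by at most one when a vertical step is put in front of the
    walk, and then only if the step goes down the tree, in which case |x| is one
    less than at the next vertex. *)
Lemma walk_meet n x y : walk tree_with n x y -> exists s,
  [/\ (s <= size x)%N, (s <= size y)%N, linked H (take s x) (take s y) &
      (size x + size y <= n + s.*2)%N].
Proof.
elim: n x => [|n IHn] x /=.
  by move=> ->; exists (size y); split=> //; [apply: linked_refl|lia].
move=> [z xz /IHn[s [sz sy szy le_zy]]].
case: xz => [[i [zx|xz]]|xz].
- have sizez : size z = (size x).+1 by rewrite zx size_rcons.
  exists (minn s (size x)); split; [lia|lia| |lia].
  have := linked_take (minn s (size x)) szy.
  rewrite !take_takel ?geq_minl//; apply: linked_trans.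
  rewrite zx -cats1 takel_cat ?geq_minr//; exact: linked_refl.
- have sizex : size x = (size z).+1 by rewrite xz size_rcons.
  exists s; split=> //; [lia| |lia].
  by rewrite xz -cats1 takel_cat.
- have sizex := Hsize xz; exists s; split=> //; [lia| |lia].
  by apply: linked_trans szy; apply/linked_take/linked_edge.
Qed.

Lemma walk_climb k x : (k <= size x)%N -> walk tree_with (size x - k) (take k x) x.
Proof.
elim/last_ind: x => [|x i IHx]; first by [].
rewrite size_rcons leq_eqVlt => /predU1P[->|].
  by rewrite subnn take_oversize ?size_rcons.
rewrite ltnS => kx; rewrite -[in take k _]cats1 takel_cat// subSn// -addn1.
apply: walk_cat (IHx kx) _; exists (rcons x i) => //.
by left; exists i; left.
Qed.

Lemma meet_walk k s x y : (s <= size x)%N -> (s <= size y)%N ->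
  walk H k (take s x) (take s y) ->
  walk tree_with ((size x - s) + (k + (size y - s))) x y.
Proof.
move=> sx sy sxy; apply: walk_cat (walk_sym tree_with_sym (walk_climb sx)) _.
apply: walk_cat (walk_climb sy).
by apply: walk_mono sxy => u v; right.
Qed.

Lemma tree_with_connected : connected_graph tree_with.
Proof.
move=> x y; exists (size x - 0 + (0 + (size y - 0)))%N.
by apply: meet_walk => //; rewrite !take0.
Qed.

Lemma tree_dist_le k s x y : (s <= size x)%N -> (s <= size y)%N ->
  walk H k (take s x) (take s y) ->
  (graph_dist tree_with x y + s.*2 <= size x + size y + k)%N.
Proof.
move=> sx sy sxy; have := graph_dist_le (meet_walk sx sy sxy); lia.
Qed.

Lemma tree_dist_ge x y : exists s,
  [/\ (s <= size x)%N, (s <= size y)%N, linked H (take s x) (take s y) &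
      (size x + size y <= graph_dist tree_with x y + s.*2)%N].
Proof.
have [n xy] := tree_with_connected x y.
exact: walk_meet (graph_dist_walk xy).
Qed.

Lemma tree_dist_root x : graph_dist tree_with [::] x = size x.
Proof.
have [s [+ _ _]] := tree_dist_ge [::] x; rewrite leqn0 => /eqP->.
have := @tree_dist_le 0 0 [::] x; rewrite !take0 => /(_ erefl erefl erefl).
rewrite /=; lia.
Qed.

(** If x, z are related at level s and z, y at level s', then x, y are related at
    level min(s, s'); up to B / 2 these levels are the Gromov products. *)
Lemma tree_with_hyperbolic (R : realType) (B : nat) :
  (forall x y, linked H x y -> exists2 k, (k <= B)%N & walk H k x y) ->
  hyperbolic R tree_with [::].
Proof.
move=> HB; exists (B%:R + 1); split.
- exact: tree_with_connected.
- by rewrite ltr_wpDl.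
- move=> x y z; rewrite /gromov_product !tree_dist_root.
  have [s [sx sz sxz xz]] := tree_dist_ge x z.
  have [s' [s'z s'y s'zy zy]] := tree_dist_ge z y.
  pose q := minn s s'.
  have qxy : linked H (take q x) (take q y).
    have := linked_take q sxz; have := linked_take q s'zy.
    rewrite !take_takel ?geq_minl ?geq_minr// => zy' xz'.
    exact: linked_trans xz' zy'.
  have [k kB qk] := HB _ _ qxy.
  have := tree_dist_le (leq_trans (geq_minl _ _) sx)
                       (leq_trans (geq_minr _ _) s'y) qk.
  move: xz zy.
  move: (graph_dist _ x z) (graph_dist _ z y) (graph_dist _ x y) => d1 d2 d3.
  move=> h1 h2 h3.
  have B0 : (0 : R) <= B%:R by [].
  have [ss'|s's] := leqP s s'.
  + have : (size x + size z + d3 <= size x + size y + B + d1)%N by lia.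
    rewrite -(ler_nat R) !natrD => h.
    rewrite lerBlDr ge_min; apply/orP; left; lra.
  + have : (size z + size y + d3 <= size x + size y + B + d2)%N by lia.
    rewrite -(ler_nat R) !natrD => h.
    rewrite lerBlDr ge_min; apply/orP; right; lra.
Qed.

End Words.

(** * Comparing the augmented tree with the bare tree *)

Section Comparison.
Variables (m : nat) (H : @word m -> @word m -> Prop).
Hypothesis Hsym : forall u v, H u v -> H v u.
Hypothesis Hsize : forall u v, H u v -> size u = size v.
Hypothesis Hparent :
  forall u v i j, H (rcons u i) (rcons v j) -> u = v \/ H u v.

Let noH (u v : @word m) := False.

Lemma vertical_tree_with : @vertical m = tree_with noH.
Proof.
apply/funext => u; apply/funext => v; apply/propext.
by split=> [|[]//]; left.
Qed.

Lemma linked_noH u v : linked noH u v -> u = v.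
Proof. by move=> [[|n]] //= [w []]. Qed.

Variables (tau : @word m -> @word m) (B : nat).
Hypothesis tau_size : forall w, size (tau w) = size w.
Hypothesis tau_take : forall k w, linked H (take k (tau w)) (tau (take k w)).
Hypothesis tau_linked :
  forall u v i j, linked H (tau (rcons u i)) (tau (rcons v j)) -> u = v.
Hypothesis HB :
  forall x y, linked H x y -> exists2 k, (k <= B)%N & walk H k x y.

(** Addresses that agree up to level s give vertices related at level s.
    Vertices related at level s > 0 are new siblings, so their addresses agree up
    to level s - 1; losing one level in each branch costs 2. *)
Lemma dist_reassignment u v :
  (graph_dist (tree_with H) (tau u) (tau v) <= graph_dist (@vertical m) u v + B)%N
  /\ (graph_dist (@vertical m) u v <= graph_dist (tree_with H) (tau u) (tau v) + 2)%N.
Proof.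
rewrite vertical_tree_with; split.
  have [//|//|//|s [su sv /linked_noH suv h]] := @tree_dist_ge m noH _ _ _ u v.
  have suv' : linked H (take s (tau u)) (take s (tau v)).
    apply: linked_trans (tau_take _ _) _; rewrite suv.
    exact/(linked_sym Hsym)/tau_take.
  have [k kB kuv] := HB suv'.
  rewrite -(tau_size u) in su h *; rewrite -(tau_size v) in sv h *.
  have := tree_dist_le Hsym su sv kuv; lia.
have [s] := tree_dist_ge Hsym Hsize Hparent (tau u) (tau v).
rewrite !tau_size => -[su sv suv h].
have {}suv : linked H (tau (take s u)) (tau (take s v)).
  apply: linked_trans (tau_take _ _); apply: linked_trans suv.
  exact/(linked_sym Hsym)/tau_take.
have eq_uv : take s.-1 u = take s.-1 v.
  case: s su sv suv {h} => [|s] su sv; first by rewrite !take0.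
  have := size_takel su; have := size_takel sv.
  case/lastP Eu: (take _ u) => [|u' i]; first by [].
  case/lastP Ev: (take _ v) => [|v' j]; first by [].
  rewrite !size_rcons => -[sv'] [su'] /tau_linked eq_uv'.
  rewrite -(take_takel u (leqnSn s)) -(take_takel v (leqnSn s)) Eu Ev.
  by rewrite -!cats1 -{1}su' -{1}sv' !take_size_cat.
have := @tree_dist_le m noH (fun _ _ => id) 0 s.-1 u v
  (leq_trans (leq_pred s) su) (leq_trans (leq_pred s) sv) eq_uv.
lia.
Qed.

End Comparison.

(** * Boundaries under a bijection that distorts D by a bounded factor *)

Section LimitSuperior.
Variables (R : realType).
Implicit Types (u v : nat -> R) (M C : R).

Lemma sups_bounds u M n :
  (forall k, 0 <= u k <= M) -> 0 <= sups u n <= M.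
Proof.
move=> uM.
have ub : has_ubound (sdrop u n) by exists M => _ [k _ <-]; case/andP: (uM k).
have un : u n <= sups u n.
  by apply: ub_le_sup => //; exists n => //=.
rewrite (le_trans _ un) /=; last by case/andP: (uM n).
apply: ge_sup; first by exists (u n), n => /=.
by move=> _ [k _ <-]; case/andP: (uM k).
Qed.

Lemma limn_sup_inf u M :
  (forall k, 0 <= u k <= M) -> limn_sup u = inf (range (sups u)).
Proof.
move=> uM; apply: limn_supE; exists M; split=> [|N /ltW MN k _ /=].
  exact: num_real.
by case/andP: (uM k) => u0 ukM; rewrite ger0_norm// (le_trans ukM).
Qed.

Lemma limn_sup_le_sups u M n : (forall k, 0 <= u k <= M) -> limn_sup u <= sups u n.
Proof.
move=> uM; rewrite (limn_sup_inf uM); apply: ge_inf; last by exists n.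
by exists 0 => _ [k _ <-]; have /andP[] := sups_bounds k uM.
Qed.

Lemma limn_sup_le_scaled u v M C :
  (forall k, 0 <= u k <= M) -> (forall k, 0 <= v k <= M) -> 0 < C ->
  (forall k, u k <= C * v k) -> limn_sup u <= C * limn_sup v.
Proof.
move=> uM vM C0 uv; rewrite -ler_pdivrMl// (limn_sup_inf vM).
apply: lb_le_inf; first by exists (sups v 0%N), 0%N.
move=> _ [n _ <-]; rewrite ler_pdivrMl//.
apply: le_trans (limn_sup_le_sups n uM) _.
apply: ge_sup; first by exists (u n), n => /=.
move=> _ [k nk <-]; apply: le_trans (uv k) _; rewrite ler_pM2l//.
apply: ub_le_sup; last by exists k.
by exists M => _ [j _ <-]; case/andP: (vM j).
Qed.

End LimitSuperior.

Definition push (V W : Type) (sigma : V -> W) (xi : set (nat -> V)) :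
    set (nat -> W) :=
  [set sigma \o x | x in xi].

Section Push.
Variables (R : realType) (V W : Type) (D : V -> V -> R) (D' : W -> W -> R).
Variables (sigma : V -> W) (C M : R).
Hypothesis C0 : 0 < C.
Hypothesis DM : forall x y, 0 <= D x y <= M.
Hypothesis D'M : forall x y, 0 <= D' x y <= M.
Hypothesis D'D : forall x y, D' (sigma x) (sigma y) <= C * D x y.

Lemma cauchy_for_push x : cauchy_for D x -> cauchy_for D' (sigma \o x).
Proof.
move=> cx e e0; have [|N xN] := cx (C^-1 * e); first by rewrite mulr_gt0 ?invr_gt0.
exists N => p q Np Nq; apply: le_lt_trans (D'D _ _) _.
by rewrite -ltr_pdivlMl//; apply: xN.
Qed.

Lemma same_limit_push x y :
  same_limit D x y -> same_limit D' (sigma \o x) (sigma \o y).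
Proof.
move=> xy; rewrite /same_limit.
apply: (@squeeze_cvgr _ _ _ _ (fun=> 0) (fun n => C * D (x n) (y n))).
- by apply: nearW => n; rewrite D'D andbT; case/andP: (D'M (sigma (x n)) (sigma (y n))).
- exact: cvg_cst.
- by rewrite -(mulr0 C); apply: cvgM (cvg_cst C) xy.
Qed.

(** Boundedness of D and D' is what makes the suprema and limits superior in
    [extended_dist] genuine, hence monotone. *)
Lemma extended_dist_push xi eta : xi !=set0 -> eta !=set0 ->
  extended_dist D' (push sigma xi) (push sigma eta) <= C * extended_dist D xi eta.
Proof.
move=> [x0 xi0] [y0 eta0]; apply: ge_sup.
  exists (limn_sup (fun n => D' (sigma (x0 n)) (sigma (y0 n)))).
  by exists (sigma \o x0); [exists x0|exists (sigma \o y0) => //; exists y0].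
move=> _ [_ [x xix <-] [_ [y etay <-] <-]].
have le_xy := @limn_sup_le_scaled _ _ (fun n => D (x n) (y n)) M C
  (fun k => D'M (sigma (x k)) (sigma (y k))) (fun k => DM _ _) C0 (fun k => D'D _ _).
apply: le_trans le_xy _.
rewrite ler_pM2l//; apply: ub_le_sup; last by exists x => //; exists y.
exists M => _ [x' _ [y' _ <-]].
have xyM n : 0 <= D (x' n) (y' n) <= M by [].
apply: le_trans (limn_sup_le_sups 0 xyM) _.
by have /andP[] := sups_bounds 0 xyM.
Qed.

End Push.

(** Points of the completion are full equivalence classes of Cauchy sequences, so
    composing with the bijection sigma maps each class exactly onto a class, with
    composition by the inverse of sigma as inverse map. *)
Lemma lipschitz_boundary (R : realType) (V W : Type)
    (D : V -> V -> R) (D' : W -> W -> R) (sigma : V -> W) (C M : R) :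
  0 < C -> bijective sigma ->
  (forall x, D x x = 0) ->
  (forall x y, 0 <= D x y <= M) -> (forall x y, 0 <= D' x y <= M) ->
  (forall x y, D' (sigma x) (sigma y) <= C * D x y) ->
  (forall x y, D x y <= C * D' (sigma x) (sigma y)) ->
  lipschitz_equivalent (completion_boundary D) (extended_dist D)
                       (completion_boundary D') (extended_dist D').
Proof.
move=> C0 [tau sK tK] D0 DM D'M D'D DD'.
have DD'tau x y : D (tau x) (tau y) <= C * D' x y.
  by apply: le_trans (DD' _ _) _; rewrite !tK.
have compK (x : nat -> V) : tau \o (sigma \o x) = x by apply/funext => n /=.
have compK' (y : nat -> W) : sigma \o (tau \o y) = y by apply/funext => n /=.
have pushK xi : push tau (push sigma xi) = xi.
  apply/seteqP; split=> [_ [_ [x xix <-] <-]|x xix]; first by rewrite compK.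
  by exists (sigma \o x); [exists x|].
have push_class x :
    push sigma (cauchy_class D x) = cauchy_class D' (sigma \o x).
  apply/seteqP; split=> [_ [y [cy xy] <-]|y [cy xy]].
    by split; [exact: cauchy_for_push C0 D'D _ cy
              |exact: same_limit_push D'M D'D _ _ xy].
  exists (tau \o y); last by [].
  split; first exact: cauchy_for_push C0 DD'tau _ cy.
  by have := @same_limit_push _ _ _ _ _ _ _ _ DM DD'tau _ _ xy; rewrite compK.
have push_class' y :
    push tau (cauchy_class D' y) = cauchy_class D (tau \o y).
  by rewrite -{1}(compK' y) -push_class pushK.
exists (push sigma); split.
  split.
  - move=> _ [[x cx <-] xconst]; split.
      by exists (sigma \o x); [exact: cauchy_for_push C0 D'D _ cx|].
    move=> [w _ ww]; apply: xconst; exists (tau w) => //.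
    by rewrite -(pushK (cauchy_class D x)) -ww push_class'.
  - by move=> xi eta _ _ /(congr1 (push tau)); rewrite !pushK.
  - move=> _ [[y cy <-] yconst].
    exists (cauchy_class D (tau \o y)); last by rewrite push_class compK'.
    split; first by exists (tau \o y) => //; exact: cauchy_for_push C0 DD'tau _ cy.
    move=> [v _ vv]; apply: yconst; exists (sigma v) => //.
    by rewrite -[in RHS](compK' y) -push_class -vv push_class.
have nonempty xi : completion_boundary D xi -> xi !=set0.
  move=> [[x cx <-] _]; exists x; split=> //.
  rewrite /same_limit; under eq_fun do rewrite D0.
  exact: cvg_cst.
exists C; split=> // xi eta /nonempty xi0 /nonempty eta0.
have push0 zeta : zeta !=set0 -> push sigma zeta !=set0.
  by move=> [z zz]; exists (sigma \o z), z.
rewrite ler_pdivrMl// (extended_dist_push C0 DM D'M D'D xi0 eta0) andbT.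
have := extended_dist_push C0 D'M DM DD'tau (push0 _ xi0) (push0 _ eta0).
by rewrite !pushK.
Qed.

(** * Estimates for rho and the horizontal edges of an IFS *)

Lemma rho_le1 (R : realType) (m : nat) (H : @word m -> @word m -> Prop) (a : R)
    x y :
  (forall u v, H u v -> H v u) ->
  (forall u v, H u v -> size u = size v) ->
  (forall u v i j, H (rcons u i) (rcons v j) -> u = v \/ H u v) ->
  0 < a -> 0 <= rho (tree_with H) [::] a x y <= 1.
Proof.
move=> Hsym Hsize Hparent a0; rewrite /rho.
case: asboolP => _; first by rewrite lexx ler01.
rewrite expR_ge0 /= -expR0 ler_expR mulNr oppr_le0 mulr_ge0 ?(ltW a0)//.
rewrite /gromov_product !tree_dist_root//.
have := @tree_dist_le _ _ Hsym 0 0 x y (leq0n _) (leq0n _).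
rewrite !take0 !addn0 => /(_ erefl); rewrite -(ler_nat R) natrD; lra.
Qed.

Lemma rho_le_rho (R : realType) (V W : Type) (E : V -> V -> Prop)
    (E' : W -> W -> Prop) o o' (a : R) n x y x' y' :
  0 < a -> (x = y <-> x' = y') ->
  graph_dist E o x = graph_dist E' o' x' ->
  graph_dist E o y = graph_dist E' o' y' ->
  (graph_dist E x y <= graph_dist E' x' y' + n)%N ->
  rho E o a x y <= expR (a * n%:R) * rho E' o' a x' y'.
Proof.
move=> a0 xy ox oy; rewrite -(ler_nat R) natrD => dxy.
rewrite /rho /gromov_product ox oy.
case: asboolP => [/xy x'y'|nxy].
  by rewrite mulr_ge0 ?expR_ge0//; case: asboolP => // _; rewrite expR_ge0.
rewrite asboolF => [|/xy//]; rewrite -expRD ler_expR.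
set G := (X in - a * X <= _); set G' := (X in _ + - a * X).
have GG' : G' - n%:R <= G.
  have : (0 : R) <= n%:R by [].
  by rewrite /G /G'; lra.
have := ler_wpM2l (ltW a0) GG'; rewrite mulrBr; lra.
Qed.

Lemma horizontal_sym (R : realType) (d m : nat)
    (S : 'I_m -> 'cV[R]_d -> 'cV[R]_d) (J : set 'cV[R]_d) u v :
  horizontal S J u v -> horizontal S J v u.
Proof.
move=> [uv suv [x [ux vx]]]; split; [exact: nesym|by []|by exists x].
Qed.

(** The cells are nested, S_(ui)(J) being contained in S_u(J), so cells of
    children can only meet if the cells of the parents do. *)
Lemma horizontal_parent (R : realType) (d m : nat)
    (S : 'I_m -> 'cV[R]_d -> 'cV[R]_d) (J : set 'cV[R]_d) u v i j :
  (forall i, S i @` J `<=` J) ->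
  horizontal S J (rcons u i) (rcons v j) -> u = v \/ horizontal S J u v.
Proof.
move=> SJ.
have cell_rcons w k : cell S J (rcons w k) `<=` cell S J w.
  move=> _ [x Jx <-]; exists (S k x); first by apply: (SJ k); exists x.
  by elim: w => //= c w ->.
move=> [_ + [x [ux vx]]]; rewrite !size_rcons => -[suv].
have [->|nuv] := pselect (u = v); first by left.
by right; split=> //; exists x; split; [apply: cell_rcons ux|apply: cell_rcons vx].
Qed.

Theorem theorem3p7 (R : realType) (d m : nat) (r : R)
  (Q : 'I_m -> 'M[R]_d) (t : 'I_m -> 'cV[R]_d)
  (J : set 'cV[R]_d)
  (kappa : nat) (cls : 'I_kappa -> set (set (@word m)))
  (b : 'cV[nat]_kappa) (A : 'M[nat]_kappa) :
  let S := fun i => similitude r (Q i) (t i) in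
  0 < r < 1 ->
  (forall i, orthogonal_mx (Q i)) ->
  J !=set0 -> bounded_set J -> closed J ->
  (forall i, S i @` J `<=` J) ->
  simple_augmented S J ->
  class_enumeration S J cls ->
  class_sizes S J cls b ->
  incidence_matrix S J cls A ->
  rearrangeable_mx m b A ->
  near_isometric R (augmented S J) [::] (@vertical m) [::] /\
  (forall a : R,
     admissible (augmented S J) [::] a ->
     admissible (@vertical m) [::] a ->
     boundary_equivalent a (augmented S J) [::] (@vertical m) [::]).
Proof.
move=> S _ _ _ _ _ SJ _ [cls_class cls_inj cls_surj] sizes incid rearr.
set H := horizontal S J.
have Hsym u v : H u v -> H v u by apply: horizontal_sym.
have Hsize u v : H u v -> size u = size v by case.
have Hparent u v i j : H (rcons u i) (rcons v j) -> u = v \/ H u v.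
  exact: horizontal_parent.
have comp_level x : horizontal_component S J (component H x).
  exists (size x); apply/component_ofP => //; last by exists x.
  by move=> u v <- /Hsize.
have classified x : exists i, connected_class S J (component H x) = cls i.
  have [|i _ <-] := cls_surj (connected_class S J (component H x)).
    by exists (component H x).
  by exists i.
have /choice[ty tyP] : forall T, exists i,
    (exists x, T = component H x) -> connected_class S J T = cls i.
  move=> T; have [[x ->]|noT] := pselect (exists x, T = component H x).
    by have [i xi] := classified x; exists i.
  by have [i _] := classified [::]; exists i => /noT.
have {tyP} tyP x : connected_class S J (component H x) = cls (ty (component H x)).
  by apply: tyP; exists x.
have bP x : (component H x #= `I_(b (ty (component H x)) ord0))%card.
  exact: sizes (comp_level x) (tyP x).
have AP x j :
    ([set Z | component_of H (successors (component H x)) Z /\ ty Z = j]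
       #= `I_(A (ty (component H x)) j))%card.
  have := incid _ _ (comp_level x) (tyP x) j.
  congr (is_true (_ #= _)%card); apply/seteqP.
  have compE Z : component_of H (successors (component H x)) Z ->
      connected_class S J Z = cls (ty Z).
    move=> /component_ofP-/(_ Hsym (@successors_component_closed _ _ Hsize Hparent x)).
    by move=> [y _ ->].
  split=> Z [xZ Zj]; split=> //; last by rewrite compE// Zj.
  by apply: cls_inj; rewrite ?inE// -compE.
pose B := (\max_i b i ord0)%N.
have HB x y : linked H x y -> exists2 k, (k <= B)%N & walk H k x y.
  move=> [n /(walk_shorten (bP x))[k kb xy]]; exists k => //.
  by apply: leq_trans kb _; apply: (@leq_bigmax _ (fun i => b i ord0)).
have [h [h1 h2 h3 h4]] := reassigned_children Hsym Hsize Hparent bP AP rearr.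
have [tau [[sigma tauK sigmaK] tau_size tau_take tau_linked]] :=
  tree_reassignment Hsym Hsize Hparent h1 h2 h3 h4.
have dist x y :
    (graph_dist (tree_with H) x y <=
       graph_dist (@vertical m) (sigma x) (sigma y) + (B + 2))%N /\
    (graph_dist (@vertical m) (sigma x) (sigma y) <=
       graph_dist (tree_with H) x y + (B + 2))%N.
  have := dist_reassignment Hsym Hsize Hparent tau_size tau_take tau_linked HB
            (sigma x) (sigma y).
  by rewrite !sigmaK; lia.
have sigma_bij : bijective sigma by exists tau.
have root x : graph_dist (@vertical m) [::] (sigma x) =
    graph_dist (tree_with H) [::] x.
  rewrite tree_dist_root// vertical_tree_with tree_dist_root//.
  by rewrite -tau_size sigmaK.
have sigma_eq x y : x = y <-> sigma x = sigma y.
  by split=> [->//|/(bij_inj sigma_bij)].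
split; first split.
- exact: (@tree_with_hyperbolic _ _ Hsym Hsize Hparent R B HB).
- rewrite vertical_tree_with.
  apply: (@tree_with_hyperbolic _ _ _ _ _ R 0) => // u v uv.
  by exists 0%N => //=; apply: linked_noH uv.
- exists sigma; split=> //; exists (B + 2)%:R; split.
    by rewrite ltr0n addn2.
  move=> x y; have [le1 le2] := dist x y.
  rewrite ler_norml lerBlDl -natrD ler_nat le2 andbT.
  by rewrite lerBrDl lerBlDr -natrD ler_nat.
move=> a [a0 _] _.
apply: (@lipschitz_boundary _ _ _ _ _ sigma (expR (a * (B + 2)%:R)) 1) => //.
- exact: expR_gt0.
- by move=> x; rewrite /rho asboolT.
- by move=> x y; apply: rho_le1.
- by move=> x y; rewrite vertical_tree_with; apply: rho_le1.
- by move=> x y; have [_ ?] := dist x y; apply: rho_le_rho => //; apply: iff_sym.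
- by move=> x y; have [? _] := dist x y; apply: rho_le_rho.
Qed.
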